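(* Let $G$ be an étale groupoid with locally compact Hausdorff unit space ($G$ not necessarily Hausdorff). Suppose that $C\subseteq G$ is dense and that $a\in\mathfrak{C}_c(G)$ is such that $a(c)=0$ for all $c\in C$. If $a(g)\neq 0$, then $g\in D$.
   Context: $G$ is a topological groupoid with unit space $X=G^{(0)}$, source $d(g)=g^{-1}g$ and range $r(g)=gg^{-1}$. An open bisection is an open subset $s\subseteq G$ on which $d$ and $r$ restrict to homeomorphisms onto open subsets of $X$; étale means that the open bisections form a base of the topology. $\mathfrak{C}_c(G)$ is the linear span of the functions $a\colon G\to\mathbb{C}$ for which there is an open bisection $s$ such that $a$ vanishes off $s$ and $a|_s$ is continuous with compact support in $s$ (such $a$ need not be continuous on $G$). An arrow $g\in G$ is dangerous if there are a net $(g_i)$ in $G$ and $h\in G\setminus\{g\}$ with $g_i\to g$ and $g_i\to h$; $D\subseteq G$ is the set of dangerous arrows. *)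

(* Defs.v *)
From HB Require Import structures.
From mathcomp Require Import all_boot all_order all_algebra.
From mathcomp Require Import all_classical all_reals all_analysis.
From mathcomp Require Import complex.

Set Implicit Arguments.
Unset Strict Implicit.
Unset Printing Implicit Defensive.

Import numFieldNormedType.Exports.
Local Open Scope classical_set_scope.
Local Open Scope ring_scope.

(* The ascription to numClosedFieldType equips C with the topology given by
   the complex modulus. *)
Definition Cplx (R : realType) : numClosedFieldType := complex R.

(* [mul] is a total function, but only its values on [composable] pairs are
   meaningful; lemma [composableP] shows that these are the pairs (g, h) with
   d(g) = r(h). *)
Record groupoid (G : Type) := Groupoid {
  composable : set (G * G);
  mul : G -> G -> G;
  inv : G -> G;
  invI : involutive inv;
  mulA : forall g h k, composable (g, h) -> composable (h, k) ->
    [/\ composable (mul g h, k), composable (g, mul h k) &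
        mul (mul g h) k = mul g (mul h k)];
  composableVl : forall g, composable (inv g, g);
  composableVr : forall g, composable (g, inv g);
  mulKl : forall g h, composable (g, h) -> mul (inv g) (mul g h) = h;
  mulKr : forall g h, composable (h, g) -> mul (mul h g) (inv g) = h }.

Section Groupoid.
Context (G : Type) (S : groupoid G).

Definition src (g : G) : G := mul S (inv S g) g.
Definition rng (g : G) : G := mul S g (inv S g).
Definition units : set G := range src.

Lemma composableP g h : composable S (g, h) <-> src g = rng h.
Proof.
split=> [gh|e].
  have [c1 _ _] := mulA gh (composableVr S h).
  have [_ c2 _] := mulA (composableVl S g) gh.
  have [_ _ e] := mulA c2 c1.
  by rewrite /src /rng -{2}(mulKr gh) -e (mulKl gh).
have [_ c1 _] := mulA (composableVr S g) (composableVl S g).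
have [c2 _ e2] := mulA (composableVr S h) (composableVl S h).
move: c1; rewrite -/(src g) e => c1.
have [_ c3 _] := mulA c1 c2.
move: c3; rewrite /rng.
suff -> : mul S (mul S h (inv S h)) h = h by [].
by have := mulKr (composableVr S h); rewrite invI.
Qed.

Lemma units_rng : units = range rng.
Proof.
by apply/seteqP; split=> _ [g _ <-]; exists (inv S g) => //;
  rewrite /src /rng invI.
Qed.

End Groupoid.

Definition topological_groupoid (G : topologicalType) (S : groupoid G) : Prop :=
  {within composable S, continuous (fun p : G * G => mul S p.1 p.2)} /\
  continuous (inv S).

Definition homeomorphic_on (T U : topologicalType) (A : set T) (f : T -> U)
    : Prop :=
  {within A, continuous f} /\
  exists2 f' : U -> T, {in A, cancel f f'} & {within f @` A, continuous f'}.

(* [units S], used as a type, carries the topology induced by that of G. *)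
Definition open_in_units (G : topologicalType) (S : groupoid G) (B : set G)
    : Prop :=
  B `<=` units S /\ open [set x : units S | B (set_val x)].

Definition open_bisection (G : topologicalType) (S : groupoid G) (s : set G)
    : Prop :=
  [/\ open s,
      homeomorphic_on s (src S) /\ open_in_units S (src S @` s) &
      homeomorphic_on s (rng S) /\ open_in_units S (rng S @` s)].

Definition etale (G : topologicalType) (S : groupoid G) : Prop :=
  basis (open_bisection S).

(* The support of a|_s is the closure relative to s of the set of points of s
   at which a is nonzero. *)
Definition elementary_fun (R : realType) (G : topologicalType) (S : groupoid G)
    (a : G -> Cplx R) : Prop :=
  exists s : set G,
    [/\ open_bisection S s,
        forall g, ~ s g -> a g = 0,
        {within s, continuous a} &
        compact (s `&` closure (s `&` [set g | a g != 0]))].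

Definition Cc (R : realType) (G : topologicalType) (S : groupoid G)
    : set (G -> Cplx R) :=
  [set a | exists (n : nat) (c : 'I_n -> Cplx R) (f : 'I_n -> G -> Cplx R),
     (forall i, elementary_fun S (f i)) /\
     a = (fun g => \sum_(i < n) c i * f i g)].

Definition directed (I : Type) (le : I -> I -> Prop) : Prop :=
  [/\ inhabited I,
      forall i, le i i,
      forall i j k, le i j -> le j k -> le i k &
      forall i j, exists k, le i k /\ le j k].

(* A net x : I -> T converges to l when [x @ tails le --> l], i.e. when x is
   eventually in each neighbourhood of l. *)
Definition tails (I : Type) (le : I -> I -> Prop) : set_system I :=
  [set P | exists i0, forall i, le i0 i -> P i].

Definition dangerous (G : topologicalType) : set G :=
  [set g | exists (I : Type) (le : I -> I -> Prop) (x : I -> G) (h : G),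
     [/\ directed le, h <> g, x @ tails le --> g & x @ tails le --> h]].

(* Main.v *)
Require Import Defs.
From mathcomp Require Import all_boot all_order all_algebra.
From mathcomp Require Import all_classical all_reals all_analysis.
From mathcomp Require Import complex.

Import numFieldNormedType.Exports.
Local Open Scope classical_set_scope.
Local Open Scope ring_scope.

(** An element of C_c(G) is continuous at every arrow g that is not dangerous.
    By linearity this concerns a single function f that vanishes off an open
    bisection s and has compact support K in s.  If g lies in s, continuity
    holds because s is open.  If g lies outside s and f is discontinuous at g,
    then f takes nonzero values in every neighbourhood of g, so that the
    neighbourhood filter of g restricted to {f != 0} is proper; it lives on the
    compact set K, hence clusters at some h in K.  This h differs from g, since
    h lies in s, and cannot be separated from g, so g is dangerous.  This is
    [elementary_continuous_at], with the net built in [cluster_dangerous].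

    A function continuous at g and nonzero there is nonzero on a neighbourhood
    of g, and so cannot vanish on a dense set. *)

(** The net is indexed by the pairs (U, V) of neighbourhoods of g and h, ordered
    by reverse inclusion, and takes at (U, V) a chosen point of the intersection
    of U and V, which is nonempty because g and h have no disjoint
    neighbourhoods. *)
Lemma cluster_dangerous (G : topologicalType) (g h : G) :
  h <> g -> cluster (nbhs g) h -> dangerous g.
Proof.
move=> hg clgh.
pose I := {W : set G * set G | nbhs g W.1 /\ nbhs h W.2}.
pose le (i j : I) :=
  (sval j).1 `<=` (sval i).1 /\ (sval j).2 `<=` (sval i).2.
have meet (i : I) : exists y, ((sval i).1 `&` (sval i).2) y.
  by case: i => -[U V] /= [gU hV]; exact: clgh.
have [x xP] := choice meet.
exists I, le, x, h; split=> //.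
- split.
  + by apply: inhabits; exists (setT, setT); split; exact: filterT.
  + by move=> i; split.
  + by move=> i j k [ij1 ij2] [jk1 jk2]; split;
      [exact: subset_trans ij1 | exact: subset_trans ij2].
  + move=> [[U V] /= [gU hV]] [[U' V'] /= [gU' hV']].
    have W : nbhs g (U `&` U') /\ nbhs h (V `&` V').
      by split; exact: filterI.
    exists (exist _ (U `&` U', V `&` V') W); split.
      by split=> y [].
    by split=> y [].
- move=> U gU.
  have W : nbhs g U /\ nbhs h setT by split=> //; exact: filterT.
  by exists (exist _ (U, setT) W) => i [iU _]; apply: iU; case: (xP i).
- move=> V hV.
  have W : nbhs g setT /\ nbhs h V by split=> //; exact: filterT.
  by exists (exist _ (setT, V) W) => i [_ iV]; apply: iV; case: (xP i).
Qed.

(** Discontinuity is only possible at points g outside the bisection s that are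
    adherent to {f != 0}; compactness of the support provides the second limit
    h inside s. *)
Lemma elementary_continuous_at (R : realType) (G : topologicalType)
    (S : groupoid G) (f : G -> Cplx R) (g : G) :
  elementary_fun S f -> ~ dangerous g -> {for g, continuous f}.
Proof.
move=> [s [[os _ _] f0 fs compK]] ndg.
have [sg|nsg] := pselect (s g).
  by move: fs; rewrite continuous_open_subspace //; apply; rewrite inE.
have [fnear0|nfnear0] := pselect (\forall x \near g, f x = 0).
  rewrite /prop_for /continuous_at f0 //.
  have near_eq : \forall x \near g, 0 = f x.
    by apply: filterS fnear0 => x ->.
  by apply: cvg_trans (near_eq_cvg near_eq) _; exact: cvg_cst.
case: ndg.
pose F := within [set x | f x != 0] (nbhs g).
have properF : ProperFilter F.
  apply: Build_ProperFilter_ex => P FP; apply: contrapT => nP.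
  have {}FP : \forall x \near g, f x != 0 -> P x by [].
  apply: nfnear0; apply: filterS FP => x Px.
  by apply: contrapT => /eqP fx; apply: nP; exists x; exact: Px.
have FK : F (s `&` closure (s `&` [set x | f x != 0])).
  rewrite /F /within /=.
  apply: filterE => x fx.
  have sx : s x by apply: contrapT => /f0 fx0; rewrite fx0 eqxx in fx.
  by split=> //; exact: subset_closure.
have [h [[sh _] clF]] := compK F properF FK.
apply: (@cluster_dangerous _ g h); first by move=> hg; apply: nsg; rewrite -hg.
by move=> U V gU hV; apply: (clF) => //; apply: filterS gU.
Qed.

Theorem proposition2 (R : realType) (G : topologicalType) (S : groupoid G)
    (topG : topological_groupoid S) (etG : etale S)
    (hausX : hausdorff_space (units S))
    (lcptX : locally_compact [set: units S])
    (C : set G) (denseC : dense C)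
    (a : G -> Cplx R) (aCc : Cc S a)
    (aC : forall c, C c -> a c = 0)
    (g : G) (ag : a g <> 0) :
  dangerous g.
Proof.
apply: contrapT => ndg.
have a_cont : {for g, continuous a}.
  case: aCc => n [c [f [fE ->]]].
  apply: cvg_big => [|i _]; first exact: add_continuous.
  apply: cvgM; first exact: cvg_cst.
  exact: elementary_continuous_at (fE i) ndg.
have a_neq0 : \forall x \near g, a x != 0.
  have open_neq0 : open [set z : Cplx R | z != 0].
    rewrite (_ : mkset _ = ~` [set 0]).
      apply: closed_openC; apply: accessible_closed_set1.
      by apply: hausdorff_accessible; exact: norm_hausdorff.
    by apply/seteqP; split=> z /= /eqP.
  have nbhs_neq0 : nbhs (a g) [set z : Cplx R | z != 0].
    by apply: open_nbhs_nbhs; split=> //; exact/eqP.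
  exact: (a_cont _ nbhs_neq0).
have [c [ac Cc]] : [set x | a x != 0]^° `&` C !=set0.
  by apply: denseC; [exists g | exact: open_interior].
by have := interior_subset ac; rewrite /= aC // eqxx.
Qed.
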